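(* Let $$A=\begin{pmatrix}0&0&0&0\\0&0&0&0\\0&0&0&-1\\0&0&1&0\end{pmatrix}\in\mathbb{M}_4(\mathbb{R}).$$ Then there does not exist any matrix $N\in\mathbb{M}_4(\mathbb{R})$ with $N^2=0$ such that the characteristic polynomial of $A+N$ is $x^4+1$.
   Context: $\mathbb{M}_4(\mathbb{R})$ is the ring of $4\times 4$ real matrices. The characteristic polynomial of $B\in\mathbb{M}_4(\mathbb{R})$ is $\det(x\,\mathrm{Id}_4-B)$. *)

(* Defs.v *)
From HB Require Import structures.
From mathcomp Require Import all_boot all_order all_algebra.
From mathcomp Require Import reals.
Set Implicit Arguments.
Unset Strict Implicit.
Unset Printing Implicit Defensive.
Import Order.TTheory GRing.Theory Num.Theory.
Local Open Scope ring_scope.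

Definition matA (R : realType) : 'M[R]_4 :=
  \matrix_(i < 4, j < 4)
    nth 0 (nth [::] [:: [:: 0; 0; 0; 0];
                        [:: 0; 0; 0; 0];
                        [:: 0; 0; 0; -1];
                        [:: 0; 0; 1; 0]] i) j.

(* Main.v *)
Require Import Defs.
From HB Require Import structures.
From mathcomp Require Import all_boot all_order all_algebra.
From mathcomp Require Import reals.
From mathcomp Require Import perm ring lra zify.
Set Implicit Arguments.
Unset Strict Implicit.
Unset Printing Implicit Defensive.
Import Order.TTheory GRing.Theory Num.Theory.
Local Open Scope ring_scope.

(** Let B = A + N with N^2 = 0 and characteristic polynomial X^4 + 1.  The
    power sums of the roots of X^4 + 1 give tr B^2 = tr B^3 = 0 and
    tr B^4 = -4.  Expanding the powers of A + N, where every cyclic word with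
    two adjacent letters N has trace zero, and using A^3 = -A and
    tr A^2 = -2, tr A = 0, this becomes
      tr (A N) = 1,   tr (A^2 N) = 0,   tr ((A N)^2) = -1
    ([mxtrace_sqr_add_sqr0], [mxtrace_cube_add_sqr0],
    [mxtrace_quart_add_sqr0]).  But only the lower right 2x2 block of N enters
    these traces: tr ((A N)^2) is the trace of the square of the lower right
    block of A N, and tr (A^2 N) = 0 says exactly that this block is
    symmetric.  The square of a real symmetric matrix has nonnegative trace
    ([mxtrace_sqr_matA_mul_ge0]), a contradiction.

    The power sums are read off from the identity
    char_poly' = tr (adj (X - B)) ([deriv_char_poly]), because for
    char_poly B = X^n + c the adjugate of X - B is the sum of the
    X^(n - 1 - i) B^i ([adj_char_poly_mx_binomial]). *)

(** * Traces of powers and the characteristic polynomial *)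

Lemma deriv_prod_seq (R : comNzRingType) (I : eqType) (r : seq I)
    (F : I -> {poly R}) :
  uniq r ->
  (\prod_(i <- r) F i)^`() =
    \sum_(i <- r) (F i)^`() * \prod_(j <- r | j != i) F j.
Proof.
elim: r => [|a r IHr] /=; first by rewrite !big_nil derivC.
case/andP=> a_r uniq_r.
rewrite big_cons derivM IHr // big_cons big_cons eqxx /=; congr (_ * _ + _).
  rewrite big_seq [RHS]big_seq_cond; apply: eq_bigl => j.
  by case: eqP => [->|_]; rewrite ?(negPf a_r) ?andbT.
rewrite mulr_sumr; apply: eq_big_seq => i r_i.
have a_i: a != i by apply: contraNneq a_r => ->.
by rewrite big_cons a_i mulrCA.
Qed.

(** Each row of X - A has derivative the corresponding row of the identity, so
    the product rule applied to the Leibniz expansion of the determinant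
    leaves, for each i, the permutations fixing i, which sum to the (i, i)
    cofactor. *)
Lemma deriv_char_poly (R : comNzRingType) (n : nat) (A : 'M[R]_n) :
  (char_poly A)^`() = \tr (\adj (char_poly_mx A)).
Proof.
rewrite /char_poly /determinant raddf_sum /=.
have deriv_entry i j : (char_poly_mx A i j)^`() = (i == j)%:R.
  by rewrite !mxE derivB derivC subr0 derivMn derivX.
transitivity (\sum_(s : 'S_n) \sum_i (s i == i)%:R * ((-1) ^+ s *
    \prod_(j | i != j) char_poly_mx A j (s j))).
  apply: eq_bigr => s _.
  have -> : ((-1) ^+ s : {poly R}) = ((-1) ^+ s)%:P.
    by rewrite rmorphXn rmorphN1.
  rewrite derivM derivC mul0r add0r deriv_prod_seq ?index_enum_uniq //.
  rewrite mulr_sumr; apply: eq_bigr => i _.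
  rewrite deriv_entry mulrCA eq_sym; congr (_ * (_ * _)).
  by apply: eq_bigl => j; rewrite eq_sym.
rewrite exchange_big /mxtrace; apply: eq_bigr => i _.
rewrite mxE expand_cofactor [RHS]big_mkcond; apply: eq_bigr => s _.
by case: eqP; rewrite ?mul1r ?mul0r.
Qed.

Lemma expr_char_poly_binomial (R : comNzRingType) (n : nat) (B : 'M[R]_n.+1)
    (c : R) :
  char_poly B = 'X^(n.+1) + c%:P -> B ^+ n.+1 = - c%:M.
Proof.
move=> charB; have := Cayley_Hamilton B.
rewrite charB rmorphD rmorphXn /= horner_mx_X horner_mx_C => /eqP.
by rewrite addr_eq0 => /eqP.
Qed.

(** By Cayley-Hamilton B^(n+1) = -c, so X^(n+1) - B^(n+1) is the scalar
    matrix of [char_poly B]; the quotient of its geometric factorization by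
    X - B is then the adjugate, as [char_poly B] is not a zero divisor. *)
Lemma adj_char_poly_mx_binomial (R : idomainType) (n : nat)
    (B : 'M[R]_n.+1) (c : R) :
  char_poly B = 'X^(n.+1) + c%:P ->
  \adj (char_poly_mx B) =
    \sum_(i < n.+1) 'X^(n - i) *: map_mx polyC (B ^+ i).
Proof.
move=> charB; set C := \sum_(i < _) _; set D := char_poly_mx B.
have mulDC : D *m C = (char_poly B)%:M.
  have -> : C = \sum_(i < n.+1) 'X%:M ^+ (n.+1.-1 - i) * map_mx polyC B ^+ i.
    by apply: eq_bigr => i _; rewrite -!rmorphXn -mul_scalar_mx.
  rewrite -[LHS]subrXX_comm; last exact: comm_scalar_mx.
  rewrite -!rmorphXn /= (expr_char_poly_binomial charB) charB.
  by rewrite raddfN /= map_scalar_mx opprK raddfD.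
have := mulmxA (\adj D) D C; rewrite mulDC mul_adj_mx -/(char_poly B).
rewrite mul_mx_scalar mul_scalar_mx => eqDC.
exact: scalemx_inj (monic_neq0 (char_poly_monic B)) _ _ eqDC.
Qed.

(** Comparison of the coefficients of X^(n - k) in
    char_poly' = tr (adj (X - B)); on the left only X^n occurs. *)
Lemma mxtrace_expr_binomial (R : idomainType) (n k : nat)
    (B : 'M[R]_n.+1) (c : R) :
  char_poly B = 'X^(n.+1) + c%:P -> (0 < k <= n)%N -> \tr (B ^+ k) = 0.
Proof.
move=> charB /andP[k_gt0 k_le]; have := deriv_char_poly B.
rewrite (adj_char_poly_mx_binomial charB) charB derivD derivC addr0 derivXn /=.
move/(congr1 (fun p : {poly R} => p`_(n - k))).
rewrite raddf_sum coef_sum coefMn coefXn.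
have ->: (n - k == n)%N = false by apply/eqP; lia.
have lt_kn : (k < n.+1)%N by [].
rewrite mul0rn (bigD1 (Ordinal lt_kn)) //= big1 ?addr0 => [|i].
  by rewrite mxtraceZ trace_map_mx coefMC coefXn eqxx mul1r.
rewrite -val_eqE /= => i_k.
rewrite mxtraceZ trace_map_mx coefMC coefXn.
case: eqP => [|_]; last exact: mul0r.
by have := ltn_ord i; move/eqP: i_k; lia.
Qed.

(** * Traces of powers of a perturbation of square zero *)

Section SquareZeroPerturbation.

Variables (R : comNzRingType) (n : nat) (A N : 'M[R]_n.+1).
Hypothesis N2_0 : N * N = 0.

Let trC (X Y : 'M[R]_n.+1) : \tr (X * Y) = \tr (Y * X).
Proof. exact: mxtrace_mulC. Qed.

Let sqrD : (A + N) ^+ 2 = A ^+ 2 + A * N + N * A.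
Proof. by rewrite expr2 mulrDl !mulrDr N2_0 addr0. Qed.

Lemma mxtrace_sqr_add_sqr0 :
  \tr ((A + N) ^+ 2) = \tr (A ^+ 2) + \tr (A * N) *+ 2.
Proof. by rewrite sqrD !raddfD /= (trC N) -addrA. Qed.

Lemma mxtrace_cube_add_sqr0 :
  \tr ((A + N) ^+ 3) = \tr (A ^+ 3) + \tr (A ^+ 2 * N) *+ 3.
Proof.
rewrite exprSr sqrD !mulrDl !mulrDr -!exprSr -(mulrA A N N) N2_0 mulr0 addr0.
rewrite !raddfD /= (trC (A * N) A) (trC (N * A) A) (trC (N * A) N).
rewrite !mulrA N2_0 mul0r mxtrace0 addr0 (trC _ A) mulrA -expr2.
by rewrite -!addrA.
Qed.

(** Among the words with two letters N only the two alternating ones,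
    ANAN and NANA, escape the cyclic vanishing; this is where a quadratic form
    in N appears. *)
Lemma mxtrace_quart_add_sqr0 :
  \tr ((A + N) ^+ 4) =
    \tr (A ^+ 4) + \tr (A ^+ 3 * N) *+ 4 + \tr ((A * N) ^+ 2) *+ 2.
Proof.
have trA2AN : \tr (A ^+ 2 * (A * N)) = \tr (A ^+ 3 * N).
  by rewrite mulrA -exprSr.
have trA2NA : \tr (A ^+ 2 * (N * A)) = \tr (A ^+ 3 * N).
  by rewrite mulrA trC mulrA -exprS.
have trNANA : \tr ((N * A) * (N * A)) = \tr ((A * N) ^+ 2).
  by rewrite -mulrA trC !mulrA -(mulrA (A * N)) -expr2.
have trNAAN : \tr ((N * A) * (A * N)) = 0.
  by rewrite trC -mulrA (mulrA N) N2_0 mul0r mulr0 mxtrace0.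
have ANNA : (A * N) * (N * A) = 0.
  by rewrite -mulrA (mulrA N) N2_0 mul0r mulr0.
rewrite (exprM (A + N) 2 2) expr2 sqrD !mulrDl !mulrDr -exprD ANNA addr0.
rewrite !raddfD /= (trC _ (A ^+ 2)) (trC (N * A) (A ^+ 2)).
rewrite trA2AN trA2NA trNANA trNAAN -expr2 add2n.
ring.
Qed.

End SquareZeroPerturbation.

(** * The given matrix *)

Lemma matA_sqr (R : realType) :
  matA R ^+ 2 = \matrix_(i, j) - ((i == j) && (1 < i)%N)%:R.
Proof.
apply/matrixP => i j; rewrite expr2 -mulmxE !mxE !big_ord_recl big_ord0 !mxE.
case: i => [[|[|[|[|i]]]]] lti //; case: j => [[|[|[|[|j]]]]] ltj //=.
all: by ring.
Qed.

Lemma matA_cube (R : realType) : matA R ^+ 3 = - matA R.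
Proof.
rewrite exprS matA_sqr; apply/matrixP => i j.
rewrite -mulmxE !mxE !big_ord_recl big_ord0 !mxE.
case: i => [[|[|[|[|i]]]]] lti //; case: j => [[|[|[|[|j]]]]] ltj //=.
all: by ring.
Qed.

Lemma mxtrace_matA_sqr (R : realType) : \tr (matA R ^+ 2) = - 2.
Proof.
by rewrite matA_sqr /mxtrace !big_ord_recl big_ord0 !mxE /=; ring.
Qed.

(** The first two rows of A N vanish, so its square has the same trace as the
    square of its lower right 2x2 block.  The off-diagonal entries of that
    block are -N_33 and N_22 (indices from 0), and tr (A^2 N) is
    -(N_22 + N_33): the hypothesis makes the block symmetric, and the trace of
    its square is the sum of the squares of its entries. *)
Lemma mxtrace_sqr_matA_mul_ge0 (R : realType) (N : 'M[R]_4) :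
  \tr (matA R ^+ 2 * N) = 0 -> 0 <= \tr ((matA R * N) ^+ 2).
Proof.
rewrite matA_sqr expr2 -!mulmxE /mxtrace.
rewrite !big_ord_recl !big_ord0 !mxE !big_ord_recl !big_ord0 !mxE /=.
rewrite !big_ord_recl !big_ord0 !mxE /=.
set i3 := lift ord0 (lift ord0 (lift ord0 ord0)).
set i2 := lift ord0 (lift ord0 ord0) => trA2N.
have -> : N i2 i2 = - N i3 i3 by lra.
rewrite [X in 0 <= X](_ : _ = N i3 i2 ^+ 2 + N i2 i3 ^+ 2 + N i3 i3 ^+ 2 *+ 2).
  by rewrite !addr_ge0 ?mulrn_wge0 ?sqr_ge0.
ring.
Qed.

Theorem mainTheorem2 (R : realType) :
  ~ exists N : 'M[R]_4, N ^+ 2 = 0 /\ char_poly (matA R + N) = 'X^4 + 1.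
Proof.
case=> N [/eqP]; rewrite expr2 => /eqP N2_0 charB.
have tr0 k : (0 < k <= 3)%N -> \tr ((matA R + N) ^+ k) = 0.
  exact: mxtrace_expr_binomial charB.
have trAN := tr0 2 isT.
rewrite mxtrace_sqr_add_sqr0 // mxtrace_matA_sqr in trAN.
have trA2N : \tr (matA R ^+ 2 * N) = 0.
  have := tr0 3 isT; rewrite mxtrace_cube_add_sqr0 // matA_cube.
  by rewrite /mxtrace !big_ord_recl !big_ord0 !mxE /=; lra.
have trANAN_ge0 := mxtrace_sqr_matA_mul_ge0 trA2N.
have trB4 := mxtrace_quart_add_sqr0 (matA R) N2_0.
rewrite (expr_char_poly_binomial (n := 3) charB) (exprS _ 3) matA_cube in trB4.
rewrite mulrN mulNr -expr2 !raddfN /= mxtrace_matA_sqr mxtrace_scalar in trB4.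
(* Here -4 = 2 - 4 tr (A N) + 2 tr ((A N)^2) with tr (A N) = 1. *)
clear - trAN trANAN_ge0 trB4; lra.
Qed.
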